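(* If $G$ and $H$ are graphs, then $$\iota(G\,\Box\, H)\le \min\{\alpha_k(G)\iota(H)+(n(G)-\alpha_k(G))\gamma(H),\ \alpha_\ell(H)\iota(G)+(n(H)-\alpha_\ell(H))\gamma(G)\},$$ where $k=\omega(I(H))$ and $\ell=\omega(I(G))$. Moreover, the bound is sharp (there exist graphs $G,H$ attaining equality).
   Context: All graphs are finite and simple; $n(G)=|V(G)|$, $G\,\Box\,H$ is the Cartesian product, $\gamma$ is the domination number, $\omega$ the clique number. For $A\subseteq V(G)$, $N[A]$ is its closed neighborhood. $A$ is an isolating set if $V(G)-N[A]$ is independent; $\iota(G)$ is the minimum size of an isolating set, and an $\iota(G)$-set is an isolating set of size $\iota(G)$. For an $\iota(G)$-set $A$, let $L_A=V(G)-N[A]$. The isolation graph $I(G)$ is the graph whose vertices are the $\iota(G)$-sets, with distinct $A,B$ adjacent whenever $L_A\cap L_B=\emptyset$. For a positive integer $k$, $\alpha_k(G)$ denotes the maximum number of vertices of an induced $k$-colorable subgraph of $G$. *)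

(* Defs.v *)
From mathcomp Require Import all_boot.

Set Implicit Arguments.
Unset Strict Implicit.
Unset Printing Implicit Defensive.

Record sgraph := SGraph {
  vertex :> finType;
  edge : rel vertex;
  edge_sym : symmetric edge;
  edge_irrefl : irreflexive edge
}.

Notation "x -- y" := (edge x y) (at level 30, no associativity).

Section CartesianProduct.
Variables G H : sgraph.

Definition cart_edge : rel (G * H) :=
  fun x y => ((x.1 == y.1) && (x.2 -- y.2)) || ((x.2 == y.2) && (x.1 -- y.1)).

Fact cart_edge_sym : symmetric cart_edge.
Proof.
move=> x y; rewrite /cart_edge (eq_sym x.1) (eq_sym x.2).
by rewrite (edge_sym x.1) (edge_sym x.2).
Qed.

Fact cart_edge_irrefl : irreflexive cart_edge.
Proof. by move=> x; rewrite /cart_edge !edge_irrefl !andbF. Qed.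

Definition cart_prod : sgraph := SGraph cart_edge_sym cart_edge_irrefl.
End CartesianProduct.

Notation "G □ H" := (cart_prod G H) (at level 40, left associativity).

Section InducedSubgraph.
Variables (G : sgraph) (S : {set G}).

Definition induced_edge : rel {x : G | x \in S} :=
  fun x y => val x -- val y.

Fact induced_edge_sym : symmetric induced_edge.
Proof. by move=> x y; rewrite /induced_edge edge_sym. Qed.

Fact induced_edge_irrefl : irreflexive induced_edge.
Proof. by move=> x; rewrite /induced_edge edge_irrefl. Qed.

Definition induced : sgraph := SGraph induced_edge_sym induced_edge_irrefl.
End InducedSubgraph.

Definition colorable (k : nat) (G : sgraph) : bool :=
  [exists f : {ffun G -> 'I_k}, forall x, forall y, (x -- y) ==> (f x != f y)].

Definition alpha (k : nat) (G : sgraph) : nat :=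
  \max_(S : {set G} | colorable k (induced S)) #|S|.

Section Invariants.
Variable G : sgraph.
Implicit Types A K : {set G}.

Definition clique K : bool :=
  [forall x in K, forall y in K, (x != y) ==> (x -- y)].

Definition omega : nat := \max_(K : {set G} | clique K) #|K|.

Definition independent A : bool :=
  [forall x in A, forall y in A, ~~ (x -- y)].

Definition closed_nbh A : {set G} :=
  [set y | [exists x in A, (x == y) || (x -- y)]].

Definition dominating A : bool := closed_nbh A == [set: G].

(* The full vertex set, the default of both arg mins below, is dominating and
   isolating, so these are genuine minima. *)
Definition gamma : nat :=
  #|[arg min_(A < [set: G] | dominating A) #|A|]|.

Definition leftover A : {set G} := ~: closed_nbh A.

Definition isolating A : bool := independent (leftover A).

Definition iota_num : nat :=
  #|[arg min_(A < [set: G] | isolating A) #|A|]|.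

Definition iota_set A : bool := isolating A && (#|A| == iota_num).
End Invariants.

Section IsolationGraph.
Variable G : sgraph.

Definition isolation_edge : rel {A : {set G} | iota_set A} :=
  fun A B => (A != B) && [disjoint leftover (val A) & leftover (val B)].

Fact isolation_edge_sym : symmetric isolation_edge.
Proof. by move=> A B; rewrite /isolation_edge eq_sym disjoint_sym. Qed.

Fact isolation_edge_irrefl : irreflexive isolation_edge.
Proof. by move=> A; rewrite /isolation_edge eqxx. Qed.

Definition isolation_graph : sgraph :=
  SGraph isolation_edge_sym isolation_edge_irrefl.
End IsolationGraph.

(* The subtraction is never truncated: alpha k G <= #|G|. *)
Definition one_sided_bound (G H : sgraph) : nat :=
  let k := omega (isolation_graph H) in
  alpha k G * iota_num H + (#|G| - alpha k G) * gamma H.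

(* Main.v *)
Require Import Defs.
From mathcomp Require Import all_boot.

Set Implicit Arguments.
Unset Strict Implicit.
Unset Printing Implicit Defensive.

(** Choose for every vertex [g] of [G] a set [F g] in the copy of [H] above [g].
    The union of these sets isolates [G □ H] as soon as every [F g] isolates
    [H] and the leftovers of [F g] and [F g'] are disjoint whenever [g -- g'].
    Fix a largest [k]-colorable induced subgraph of [G] and a largest clique of
    the isolation graph of [H], and let the colors name the members of the
    clique: taking the named set on the colored vertices and a minimum
    dominating set (whose leftover is empty) elsewhere gives the bound.  The
    second bound is the first one for [H □ G].  Equality holds for the product
    of the one-vertex graph with a single edge. *)

Section Isolation.
Variable G : sgraph.
Implicit Types A B : {set G}.

Lemma leftoverP A y :
  reflect (forall x, x \in A -> (x != y) && ~~ (x -- y)) (y \in leftover A).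
Proof.
rewrite !inE negb_exists.
apply: (iffP forallP) => [h x xA | h x]; first by have := h x; rewrite xA negb_or.
by rewrite negb_and negb_or; case: (boolP (x \in A)) => // /h.
Qed.

Lemma isolatingP A :
  reflect {in leftover A &, forall x y, ~~ (x -- y)} (isolating A).
Proof.
apply: (iffP forall_inP) => [h x y /h /forall_inP | h x xL]; first exact.
by apply/forall_inP => y; apply: h.
Qed.

Lemma leftover_dominating A : dominating A -> leftover A = set0.
Proof. by rewrite /leftover => /eqP->; rewrite setCT. Qed.

Lemma dominating_isolating A : dominating A -> isolating A.
Proof.
by move=> /leftover_dominating LA; apply/isolatingP => x y; rewrite LA inE.
Qed.

Lemma dominating_setT : dominating [set: G].
Proof.
apply/eqP/setP => x; rewrite !inE; apply/existsP.
by exists x; rewrite inE eqxx.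
Qed.

Lemma iota_num_min A : isolating A -> iota_num G <= #|A|.
Proof.
rewrite /iota_num; case: arg_minnP => [|B _]; last exact.
exact: dominating_isolating dominating_setT.
Qed.

Lemma iota_num_attained : exists2 A : {set G}, isolating A & #|A| = iota_num G.
Proof.
rewrite /iota_num; case: arg_minnP => [|B isoB _]; last by exists B.
exact: dominating_isolating dominating_setT.
Qed.

Lemma gamma_min A : dominating A -> gamma G <= #|A|.
Proof.
by rewrite /gamma; case: arg_minnP => [|B _]; [exact: dominating_setT | exact].
Qed.

Lemma gamma_attained : exists2 A : {set G}, dominating A & #|A| = gamma G.
Proof.
rewrite /gamma; case: arg_minnP => [|B domB _]; last by exists B.
exact: dominating_setT.
Qed.

Lemma iota_num_gamma : iota_num G <= gamma G.
Proof.
by have [A domA <-] := gamma_attained; apply/iota_num_min/dominating_isolating.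
Qed.

(** The empty set leaves every vertex over, so it cannot isolate a graph with an edge. *)
Lemma iota_num_gt0 (x y : G) : x -- y -> 0 < iota_num G.
Proof.
move=> xy; have [A /isolatingP isoA <-] := iota_num_attained.
rewrite card_gt0; apply: contraTneq xy => A0.
by apply: isoA; apply/leftoverP => z; rewrite A0 inE.
Qed.

Lemma omega_attained : exists2 K : {set G}, clique K & #|K| = omega G.
Proof.
have clique0 : 0 < #|@clique G|.
  by apply/card_gt0P; exists set0; apply/forall_inP => x; rewrite inE.
have [K cK maxK] := eq_bigmax_cond (fun K : {set G} => #|K|) clique0.
by exists K; last exact: esym maxK.
Qed.

Lemma alpha_attained k :
  exists2 S : {set G}, colorable k (induced S) & #|S| = alpha k G.
Proof.
(* A maximum is attained only over a nonempty family. The empty set belongs to it even for [k = 0],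
   since a map from an empty type needs no colors. *)
have colorable0 : 0 < #|[pred S : {set G} | colorable k (induced S)]|.
  apply/card_gt0P; exists set0; apply/existsP.
  have no_vertex (x : induced (set0 : {set G})) : False.
    by have := valP x; rewrite inE.
  exists [ffun x => False_rect _ (no_vertex x)].
  by apply/forallP => x; case: (no_vertex x).
have [S cS maxS] := eq_bigmax_cond (fun S : {set G} => #|S|) colorable0.
by exists S; last exact: esym maxS.
Qed.

End Isolation.

Section FiberwiseIsolation.
Variables (G H : sgraph) (F : G -> {set H}).

Definition fiber_union : {set G □ H} := [set p : G * H | p.2 \in F p.1].

Lemma card_fiber_union : #|fiber_union| = \sum_g #|F g|.
Proof.
rewrite -sum1dep_card -(pair_big_dep predT (fun g h => h \in F g) (fun _ _ => 1)) /=.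
by apply: eq_bigr => g _; rewrite sum1_card.
Qed.

(** Each fiber is a copy of [H], so [F g] dominates there whatever it dominates in [H]. Edges
    between fibers can only shrink the leftover further, hence a single implication. *)
Lemma leftover_fiber_union (p : G □ H) :
  p \in leftover fiber_union -> p.2 \in leftover (F p.1).
Proof.
case: p => g h /leftoverP Lp; apply/leftoverP => h' h'F.
have /Lp : ((g, h') : G □ H) \in fiber_union by rewrite inE.
by rewrite xpair_eqE /= /cart_edge /= eqxx edge_irrefl andbF orbF.
Qed.

(** An edge between two leftover vertices either stays in one fiber, against isolation by [F g], or
    joins copies of one vertex of [H] over adjacent [g] and [g'], against disjointness. *)
Lemma iota_cart_le_fibers :
  (forall g, isolating (F g)) ->
  (forall g g', g -- g' -> [disjoint leftover (F g) & leftover (F g')]) ->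
  iota_num (G □ H) <= \sum_g #|F g|.
Proof.
move=> isoF disjF; rewrite -card_fiber_union; apply/iota_num_min/isolatingP.
move=> [g h] [g' h'] /leftover_fiber_union /= Lh /leftover_fiber_union /= Lh'.
apply/negP => /orP[] /= /andP[/eqP eq_c adj].
  by rewrite -eq_c in Lh'; have /isolatingP/(_ h h' Lh Lh') := isoF g; rewrite adj.
by rewrite -eq_c in Lh'; rewrite (disjointFr (disjF _ _ adj) Lh) in Lh'.
Qed.

End FiberwiseIsolation.

Lemma iota_cart_le_colored (G H : sgraph) (S : {set G})
    (K : {set isolation_graph H}) :
  clique K -> colorable #|K| (induced S) ->
  iota_num (G □ H) <= #|S| * iota_num H + (#|G| - #|S|) * gamma H.
Proof.
move=> /forall_inP cliqueK /existsP[c /forallP colc].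
have [D domD cardD] := gamma_attained H.
(* [insub] succeeds exactly on [S]; the color of [g] is then an index into the enumeration of
   [K]. *)
pose F g := if insub g : option (induced S) is Some u
            then val (enum_val (c u)) else D.
have F_in g (gS : g \in S) : F g = val (enum_val (c (Sub g gS))).
  by rewrite /F insubT.
have F_out g : g \notin S -> F g = D by move=> gS; rewrite /F insubN.
have -> : #|S| * iota_num H + (#|G| - #|S|) * gamma H = \sum_g #|F g|.
  have <- : #|~: S| = #|G| - #|S| by rewrite cardsCs setCK.
  rewrite (bigID (mem S)) /= -cardD -!sum_nat_const.
  congr (_ + _); last by apply: eq_big => g; rewrite ?inE // => /F_out->.
  apply: eq_bigr => g gS; rewrite F_in.
  by have /andP[_ /eqP->] := valP (enum_val (c (Sub g gS))).
apply: iota_cart_le_fibers => [g | g g' adj].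
  have [gS | /F_out->] := boolP (g \in S); last exact: dominating_isolating.
  by rewrite F_in; have /andP[] := valP (enum_val (c (Sub g gS))).
(* This settles every edge with an end outside [S]. *)
have disjD (A : {set H}) : [disjoint leftover D & A].
  by rewrite (leftover_dominating domD) -setI_eq0 set0I.
have [gS | /F_out->] := boolP (g \in S); last exact: disjD.
have [g'S | /F_out->] := boolP (g' \in S); last by rewrite disjoint_sym disjD.
rewrite !F_in.
have /forall_inP adjK := cliqueK _ (enum_valP (c (Sub g gS))).
have := adjK _ (enum_valP (c (Sub g' g'S))).
(* Adjacent vertices of [S] have distinct colors, which index distinct and hence adjacent members of
   the clique. *)
rewrite (inj_eq enum_val_inj).
have /forallP/(_ (Sub g' g'S))/implyP/(_ adj)-> := colc (Sub g gS).
by case/andP.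
Qed.

Lemma iota_cart_le (G H : sgraph) : iota_num (G □ H) <= one_sided_bound G H.
Proof.
rewrite /one_sided_bound; have [K cliqueK <-] := omega_attained (isolation_graph H).
have [S colS <-] := alpha_attained G #|K|.
exact: iota_cart_le_colored cliqueK colS.
Qed.

(** Exchanging coordinates is a graph isomorphism, so it carries a minimum isolating set to an
    isolating set of the same size. *)
Lemma iota_cart_swap (G H : sgraph) : iota_num (G □ H) <= iota_num (H □ G).
Proof.
have [A /isolatingP isoA <-] := iota_num_attained (H □ G).
pose swap (p : H * G) : G □ H := (p.2, p.1).
have swapK (p : G □ H) : swap (p.2, p.1) = p by case: p.
have swap_edge (p q : H □ G) : swap p -- swap q = p -- q by exact: orbC.
have swap_inj : injective swap by move=> [? ?] [? ?] [-> ->].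
have swapL p : swap p \in leftover (swap @: A) -> p \in leftover A.
  move=> /leftoverP Lp; apply/leftoverP => q /(imset_f swap)/Lp.
  by rewrite (inj_eq swap_inj) swap_edge.
rewrite -(card_imset _ swap_inj); apply/iota_num_min/isolatingP => p q.
rewrite -(swapK p) -(swapK q) swap_edge => /swapL Lp /swapL Lq.
exact: isoA.
Qed.

Section CompleteGraph.
Variable T : finType.

Fact complete_edge_sym : symmetric (fun x y : T => x != y).
Proof. by move=> x y; rewrite eq_sym. Qed.

Fact complete_edge_irrefl : irreflexive (fun x y : T => x != y).
Proof. by move=> x; rewrite eqxx. Qed.

Definition complete : sgraph := SGraph complete_edge_sym complete_edge_irrefl.

Lemma gamma_complete (x : T) : gamma complete <= 1.
Proof.
rewrite -(cards1 (x : complete)); apply: gamma_min.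
apply/eqP/setP => y; rewrite !inE; apply/existsP.
by exists x; rewrite inE eqxx /= orbN.
Qed.

End CompleteGraph.

(** Replacing [iota_num H] by the larger [gamma H] removes [alpha] and [omega], so neither has to be
    computed for the sharpness example. *)
Lemma one_sided_bound_gamma (G H : sgraph) :
  one_sided_bound G H <= #|G| * gamma H.
Proof.
rewrite /one_sided_bound.
have [S _ <-] := alpha_attained G (omega (isolation_graph H)).
rewrite -[in leqRHS](subnKC (max_card (mem S))) mulnDl leq_add2r.
by rewrite leq_mul2l iota_num_gamma orbT.
Qed.

Theorem theorem3p2 :
  (forall G H : sgraph,
     iota_num (G □ H) <= minn (one_sided_bound G H) (one_sided_bound H G)) /\
  (exists G H : sgraph,
     0 < iota_num (G □ H) /\
     iota_num (G □ H) = minn (one_sided_bound G H) (one_sided_bound H G)).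
Proof.
have bound G H :
    iota_num (G □ H) <= minn (one_sided_bound G H) (one_sided_bound H G).
  rewrite leq_min iota_cart_le /=.
  exact: leq_trans (iota_cart_swap G H) (iota_cart_le H G).
split=> //; exists (complete unit), (complete bool).
(* The product is a single edge. Its positive isolation number rules out a trivial equality of zeros
   and meets the upper bound, which is at most [1 * gamma (complete bool)], hence at most 1. *)
have iota_gt0 : 0 < iota_num (complete unit □ complete bool).
  exact: (@iota_num_gt0 (complete unit □ complete bool) (tt, true) (tt, false)).
split=> //; apply/eqP; rewrite eqn_leq bound /=.
apply: leq_trans iota_gt0; rewrite geq_min.
apply/orP; left; apply: leq_trans (one_sided_bound_gamma _ _) _.
by rewrite card_unit mul1n; exact: (gamma_complete true).
Qed.
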